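(* There exists a function $f$ such that for every bull-free graph $G$, $\chi(G)\le f(\chi_T(G),\omega(G))$.
   Context: The bull is the graph with vertex set $\{x_1,x_2,x_3,y,z\}$ and edge set $\{x_1x_2,x_1x_3,x_2x_3,x_1y,x_2z\}$; a graph is bull-free if it has no induced subgraph isomorphic to the bull. $\chi(G)$ is the chromatic number, $\omega(G)$ the maximum size of a clique, and $\chi_T(G)$ (the triangle-free chromatic number) is the maximum chromatic number of a triangle-free induced subgraph of $G$. *)

(* Defs.v *)
From mathcomp Require Import all_boot.

Set Implicit Arguments.
Unset Strict Implicit.
Unset Printing Implicit Defensive.

Record sgraph := SGraph {
  vertex :> finType;
  adj : rel vertex;
  adj_sym : symmetric adj;
  adj_irr : irreflexive adj
}.

Section Induced.
Variables (G : sgraph) (A : {set G}).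

Definition induced_adj : rel {x : G | x \in A} :=
  fun u v => adj (val u) (val v).

Lemma induced_sym : symmetric induced_adj.
Proof. by move=> u v; apply: adj_sym. Qed.

Lemma induced_irr : irreflexive induced_adj.
Proof. by move=> u; apply: adj_irr. Qed.

Definition induced : sgraph := SGraph induced_sym induced_irr.
End Induced.

Definition isomorphic (G H : sgraph) : Prop :=
  exists2 f : G -> H, bijective f & forall x y, adj (f x) (f y) = adj x y.

(* x_1, x_2, x_3, y, z are numbered 0, 1, 2, 3, 4. *)
Definition bull_edges : seq (nat * nat) :=
  [:: (0, 1); (0, 2); (1, 2); (0, 3); (1, 4)].

Definition bull_adj : rel 'I_5 := fun i j =>
  ((i : nat, j : nat) \in bull_edges) || ((j : nat, i : nat) \in bull_edges).

Lemma bull_sym : symmetric bull_adj.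
Proof. by move=> i j; rewrite /bull_adj orbC. Qed.

Lemma bull_irr : irreflexive bull_adj.
Proof. by case; do 5?[case=> //]. Qed.

Definition bull : sgraph := SGraph bull_sym bull_irr.

Definition bull_free (G : sgraph) : Prop :=
  forall A : {set G}, ~ isomorphic (induced A) bull.

Definition colorable (G : sgraph) (k : nat) : bool :=
  [exists c : {ffun G -> 'I_k}, forall x, forall y, adj x y ==> (c x != c y)].

Lemma ex_colorable (G : sgraph) : exists k, colorable G k.
Proof.
exists #|G|; apply/existsP; exists [ffun x => enum_rank x].
apply/forallP=> x; apply/forallP=> y; apply/implyP=> xy.
rewrite !ffunE; apply: contraTneq xy => /enum_rank_inj->.
by rewrite adj_irr.
Qed.

Definition chi (G : sgraph) : nat := ex_minn (ex_colorable G).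

Definition clique (G : sgraph) (A : {set G}) : bool :=
  [forall x in A, forall y in A, (x != y) ==> adj x y].

Definition omega (G : sgraph) : nat := \max_(A : {set G} | clique A) #|A|.

Definition triangle_free (G : sgraph) : bool :=
  ~~ [exists x : G, exists y : G, exists z : G,
        [&& adj x y, adj y z & adj x z]].

Definition chiT (G : sgraph) : nat :=
  \max_(A : {set G} | triangle_free (induced A)) chi (induced A).

(* Main.v *)
(** Induct on the clique number. Colour a connected graph by its distance layers
    [L_k] from a vertex [v], using disjoint palettes for even and odd [k]. For
    [k >= 2] and [u] in [L_(k-1)], a neighbour of [u] in [L_(k-2)] serves as a
    horn of a bull, so every component of [N(u)] inside a component [D] of [L_k]
    is a module of [D]. If [D] is neither a join nor contained in some [N(u)],
    its maximal proper modules partition it and have smaller clique number, as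
    some vertex outside is complete to them. A transversal [X] of this partition
    meets every [N(u)] in a stable set, and bull-freeness then lifts every clique
    of size at least 3 in [X] to a clique of parents in [L_(k-1)]. For [k = 2]
    the lifted clique lies in [N(v)], while for [k >= 3] it produces a bull, so
    [X] has smaller clique number as well. Hence both the modules and [X] have
    bounded chromatic number, and product colouring handles [D]. *)

Require Import Defs.
From mathcomp Require Import all_boot.

Set Implicit Arguments.
Unset Strict Implicit.
Unset Printing Implicit Defensive.

(** * Colourings and clique bounds for vertex subsets *)

Section SetColoring.
Variable G : sgraph.
Implicit Types (A B D K L M N S X : {set G}) (x y z u v : G) (m n k w : nat).

Definition set_colorable A n : Prop :=
  exists2 c : G -> nat, {in A, forall x, c x < n} &
    {in A &, forall x y, adj x y -> c x != c y}.

Definition clique_bound A w : Prop :=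
  forall K, K \subset A -> clique K -> #|K| <= w.

Lemma set_colorable_le A B m n :
  B \subset A -> m <= n -> set_colorable A m -> set_colorable B n.
Proof.
move=> /subsetP sBA le_mn [c cA cE]; exists c.
  by move=> x /sBA/cA cx; apply: leq_trans le_mn.
by move=> x y /sBA xA /sBA yA; apply: cE.
Qed.

Lemma set_colorableU A B m n :
  set_colorable A m -> set_colorable B n -> set_colorable (A :|: B) (m + n).
Proof.
move=> [c cA cE] [d dB dE].
exists (fun x => if x \in A then c x else m + d x) => [x|x y].
  rewrite inE; case: ifP => [xA _|_ /= xB].
    exact: leq_trans (cA x xA) (leq_addr _ _).
  by rewrite ltn_add2l dB.
rewrite !inE; case: ifP => xA; case: ifP => yA /= xAB yAB xy.
- exact: cE.
- by rewrite neq_ltn (leq_trans (cA x xA)) ?leq_addr.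
- by rewrite neq_ltn (leq_trans (cA y yA)) ?leq_addr ?orbT.
- by rewrite eqn_add2l dE.
Qed.

(** Product colouring: [c0 x] and the colour of [x] within its fibre of [r] are coded as one number
    below [k * m]. The first coordinate separates edges between fibres, the second those inside a
    fibre. *)
Lemma set_colorable_fibers (I : eqType) A (r : G -> I) (c0 : G -> nat) k m :
  {in A, forall x, c0 x < k} ->
  {in A &, forall x y, adj x y -> r x != r y -> c0 x != c0 y} ->
  {in A, forall x, set_colorable [set y in A | r y == r x] m} ->
  set_colorable A (k * m).
Proof.
move=> c0A c0E fib.
have /fin_all_exists[c cP] x : exists c : G -> nat, x \in A ->
    {in [set y in A | r y == r x], forall y, c y < m} /\
    {in [set y in A | r y == r x] &, forall y z, adj y z -> c y != c z}.
  case: (boolP (x \in A)) => [/fib[c c1 c2]|_]; last by exists (fun=> 0).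
  by exists c.
(* [rep x] depends only on [r x], so a whole fibre shares one colouring; the default [x] is never
   reached on [A]. *)
pose rep x := odflt x [pick y in A | r y == r x].
have repP x : x \in A -> (rep x \in A) /\ r (rep x) = r x.
  by move=> xA; rewrite /rep; case: pickP => [y /andP[yA /eqP]|/(_ x)] //=.
have rep_eq x y : x \in A -> r x = r y -> rep x = rep y.
  move=> xA rxy; rewrite /rep rxy; case: pickP => //= /(_ x).
  by rewrite /= xA rxy eqxx.
have fibP x : x \in A -> x \in [set y in A | r y == r (rep x)].
  by move=> xA; rewrite inE xA (repP x xA).2 /=.
have cA x : x \in A -> c (rep x) x < m.
  by move=> xA; apply: (cP _ (repP x xA).1).1; apply: fibP.
exists (fun x => c0 x * m + c (rep x) x) => [x xA|x y xA yA xy].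
  apply: (@leq_trans ((c0 x).+1 * m)).
    by rewrite mulSnr ltn_add2l cA.
  by rewrite leq_mul2r c0A ?orbT.
have m_gt0 : 0 < m by apply: leq_ltn_trans (cA x xA).
apply/eqP => eqc.
have eq0 : c0 x = c0 y.
  have := congr1 (divn^~ m) eqc.
  by rewrite /= !divnMDl // !divn_small ?cA // !addn0.
move: eqc; rewrite eq0 => /addnI.
case: (eqVneq (r x) (r y)) => [rxy|/(c0E x y xA yA xy)]; last by rewrite eq0 eqxx.
rewrite (rep_eq x y xA rxy) => /eqP; apply/negP.
apply: (cP _ (repP y yA).1).2 xy; last exact: fibP.
by rewrite inE xA rxy (repP y yA).2 /=.
Qed.

(** * Connected components inside a vertex set *)

Definition adj_in A : rel G := fun x y => [&& x \in A, y \in A & adj x y].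

Definition component A x : {set G} := [set y | connect (adj_in A) x y].

Lemma adj_in_sym A : symmetric (adj_in A).
Proof. by move=> x y; rewrite /adj_in adj_sym andbCA. Qed.

Lemma connect_adj_in_sym A : connect_sym (adj_in A).
Proof. exact: sym_connect_sym (adj_in_sym A). Qed.

Lemma mem_component A x : x \in component A x.
Proof. by rewrite inE. Qed.

Lemma component_sub A x : x \in A -> component A x \subset A.
Proof.
move=> xA; apply/subsetP=> y; rewrite inE => /connectP[p].
elim: p x xA => [x xA _ ->|z p IHp x xA] //=.
by case/andP=> /and3P[_ zA _]; apply: IHp.
Qed.

Lemma component_adj A x y z :
  x \in A -> y \in component A x -> z \in A -> adj y z -> z \in component A x.
Proof.
move=> xA yC zA yz; have yA := subsetP (component_sub xA) _ yC.
move: yC; rewrite !inE => /connect_trans; apply; apply: connect1.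
by rewrite /adj_in yA zA.
Qed.

Lemma component_connected A x S : x \in A ->
  S \subset component A x -> S != set0 -> S != component A x ->
  exists y z, [/\ y \in S, z \in component A x :\: S & adj y z].
Proof.
move=> xA sSC /set0Pn[s sS] neSC.
have [z zC zS] : exists2 z, z \in component A x & z \notin S.
  apply/subsetPn; apply: contraNN neSC => sCS.
  by rewrite eqEsubset sSC.
have : connect (adj_in A) s z.
  have := subsetP sSC _ sS; move: zC; rewrite !inE.
  by rewrite (connect_adj_in_sym A x s) => xz sx; apply: connect_trans sx xz.
case/connectP=> p; elim: p s sS => [s sS _ zs|y p IHp s sS] /=.
  by rewrite zs /= sS in zS.
case/andP=> sy yp zl; case: (boolP (y \in S)) => yS; first exact: IHp yS yp zl.
case/and3P: sy => sA yA sy; exists s, y; split=> //.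
by rewrite inE yS (component_adj xA _ yA sy) // (subsetP sSC).
Qed.

Lemma set_colorable_components A n :
  {in A, forall x, set_colorable (component A x) n} -> set_colorable A n.
Proof.
move=> colC; rewrite -[n]mul1n.
apply: (@set_colorable_fibers _ A (root (adj_in A)) (fun=> 0)) => //.
  move=> x y xA yA xy; rewrite (root_connect (connect_adj_in_sym A)).
  by rewrite connect1 // /adj_in xA yA.
move=> x /colC; apply: set_colorable_le => //.
apply/subsetP=> y; rewrite !inE (root_connect (connect_adj_in_sym A)).
by rewrite connect_adj_in_sym => /andP[].
Qed.

(** Adding [u] to a clique of [B] gives a clique of [A] with one more vertex. This is the main
    source of smaller clique numbers. *)
Lemma clique_boundS A B u w : clique_bound A w.+1 -> u \in A -> B \subset A ->
  {in B, forall x, adj u x} -> clique_bound B w.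
Proof.
move=> bA uA sBA uB K sKB /forall_inP cK.
have uK : u \notin K.
  by apply/negP=> /(subsetP sKB)/uB; rewrite adj_irr.
rewrite -ltnS; have := cardsU1 u K; rewrite uK add1n => <-.
apply: bA; first by rewrite subUset sub1set uA (subset_trans sKB).
apply/forall_inP=> x; rewrite !inE => xK.
apply/forall_inP=> y; rewrite !inE => yK; apply/implyP.
case/orP: xK => [/eqP->|xK]; case/orP: yK => [/eqP->|yK].
- by rewrite eqxx.
- by rewrite uB // (subsetP sKB).
- by rewrite adj_sym uB // (subsetP sKB).
- by move: (cK x xK) => /forall_inP/(_ y yK)/implyP.
Qed.

(** * Distance layers *)

(** On the component of [v], [d x] is the length of a shortest walk from [v] to [x], and [par x] is
    the last vertex before [x] on such a walk. *)
Lemma component_layers A v : v \in A ->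
  exists (d : G -> nat) (par : G -> G),
  [/\ d v = 0,
      {in component A v &, forall x y, adj x y -> d y <= (d x).+1} &
      {in component A v, forall x, x != v ->
        [/\ par x \in component A v, adj (par x) x & d x = (d (par x)).+1]}].
Proof.
move=> vA.
(* [reach n] holds the ends of walks with exactly [n] edges; minimality enters only with the choice
   of [d]. *)
pose reach := fix reach n := if n is n'.+1 then
  [set y in A | [exists x in reach n', adj x y]] else [set v].
have reachC n : reach n \subset component A v.
  elim: n => [|n IHn] /=; first by rewrite sub1set mem_component.
  apply/subsetP=> y; rewrite inE => /andP[yA /exists_inP[x /(subsetP IHn) xC xy]].
  exact: component_adj xy.
have /fin_all_exists[d dP] x : exists n, x \in component A v ->
    x \in reach n /\ (forall m, x \in reach m -> n <= m).
  case: (boolP (x \in component A v)) => [xC|_]; last by exists 0.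
  have exn : exists n, x \in reach n.
    move: xC; rewrite inE => /connectP[p].
    elim/last_ind: p x => [x _ ->|p y IHp x]; first by exists 0; rewrite inE.
    rewrite rcons_path last_rcons => /andP[vp /and3P[_ yA ly]] ->.
    have [n nP] := IHp _ vp erefl; exists n.+1; rewrite /= inE yA /=.
    by apply/exists_inP; exists (last v p).
  by case: (ex_minnP exn) => n xn min_n; exists n.
have vC := mem_component A v.
have /fin_all_exists[par parP] x : exists y, x \in component A v -> x != v ->
    [/\ y \in component A v, adj y x & d x = (d y).+1].
  case: (boolP ((x \in component A v) && (x != v))); last first.
    by move=> nx; exists x => xC xv; rewrite xC xv in nx.
  case/andP=> xC xv; have [xd dmin] := dP x xC.
  case dx: (d x) => [|n].
    by move: xd; rewrite dx inE (negPf xv).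
  move: xd; rewrite dx /= inE => /andP[xA /exists_inP[y yn yx]].
  have yC := subsetP (reachC n) _ yn; have [yd ymin] := dP y yC.
  (* [d y <= n] since [y] lies in [reach n]; conversely [x] is reached one step after [y], so
     [n.+1 = d x <= (d y).+1]. *)
  exists y => _ _; split=> //; congr _.+1; apply/eqP.
  rewrite eqn_leq ymin // andbT -ltnS -dx dmin //= inE xA /=.
  by apply/exists_inP; exists y.
exists d, par; split=> //.
  by apply/eqP; rewrite -leqn0; apply: (dP v vC).2; rewrite inE.
move=> x y xC yC xy; apply: (dP y yC).2; rewrite /= inE.
rewrite (subsetP (component_sub vA) _ yC) /=.
by apply/exists_inP; exists x => //; case: (dP x xC).
Qed.

(** * Modules *)

Definition module D M :=
  (M \subset D) &&
  [forall z in D :\: M, forall x in M, forall y in M, adj z x == adj z y].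

Lemma moduleP D M :
  reflect (M \subset D /\
    forall z x y, z \in D -> z \notin M -> x \in M -> y \in M -> adj z x = adj z y)
  (module D M).
Proof.
apply: (iffP andP) => -[sMD modM]; split=> //.
  move=> z x y zD zM xM yM; have zDM : z \in D :\: M by rewrite inE zM.
  by move/forall_inP: modM => /(_ z zDM)/forall_inP/(_ x xM)/forall_inP/(_ y yM)/eqP.
apply/forall_inP=> z; rewrite inE => /andP[zM zD].
by apply/forall_inP=> x xM; apply/forall_inP=> y yM; apply/eqP; apply: modM.
Qed.

Lemma module1 D x : x \in D -> module D [set x].
Proof.
move=> xD; apply/moduleP; split; first by rewrite sub1set.
by move=> z a b _ _ /set1P-> /set1P->.
Qed.

Lemma moduleU D M N x :
  module D M -> module D N -> x \in M -> x \in N -> module D (M :|: N).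
Proof.
case/moduleP=> sM mM /moduleP[sN mN] xM xN.
apply/moduleP; split; first by rewrite subUset sM.
have toM z a : z \in D -> z \notin M :|: N -> a \in M :|: N -> adj z a = adj z x.
  move=> zD; rewrite !inE negb_or => /andP[zM zN] /orP[aM|aN].
    exact: mM.
  exact: mN.
by move=> z a b zD zMN aM bM; rewrite (toM z a) // (toM z b).
Qed.

Definition connected_set D : Prop :=
  forall S, S \subset D -> S != set0 -> S != D ->
  exists y z, [/\ y \in S, z \in D :\: S & adj y z].

(** Such an [S] witnesses that the complement graph on [D] is disconnected. *)
Definition join_split D S :=
  [&& S \subset D, S != set0, S != D &
      [forall x in S, forall y in D :\: S, adj x y]].

Lemma join_splitP D S : S \subset D -> S != set0 -> S != D ->
  (forall x y, x \in S -> y \in D -> y \notin S -> adj x y) -> join_split D S.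
Proof.
move=> sSD S0 SD Sjoin; apply/and4P; split=> //.
apply/forall_inP=> x xS; apply/forall_inP=> y; rewrite inE => /andP[yS yD].
exact: Sjoin.
Qed.

(** Each side of the join lies in the neighbourhood of a vertex of the other side, so both have
    smaller clique number; they get disjoint palettes. *)
Lemma join_split_colorable A D S n w : D \subset A -> clique_bound A w.+1 ->
  (forall B, clique_bound B w -> set_colorable B n) ->
  join_split D S -> set_colorable D (n + n).
Proof.
move=> sDA bA colB /and4P[sSD S0 neSD /forall_inP Sjoin].
have [x xS] := set0Pn _ S0.
have [y yD yS] : exists2 y, y \in D & y \notin S.
  by apply/subsetPn; apply: contraNN neSD => sDS; rewrite eqEsubset sSD.
have yDS : y \in D :\: S by rewrite inE yS.
have -> : D = S :|: (D :\: S) by rewrite -{1}(setID D S) (setIidPr sSD).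
apply: set_colorableU; apply: colB.
  apply: (clique_boundS bA (subsetP sDA _ yD)); first exact: subset_trans sDA.
  by move=> z zS; rewrite adj_sym; move/forall_inP: (Sjoin z zS); apply.
apply: (clique_boundS bA (u := x)).
- by apply: (subsetP sDA); apply: (subsetP sSD).
- by apply: subset_trans sDA; apply: subsetDl.
- by move=> z zD; move/forall_inP: (Sjoin x xS); apply.
Qed.

(** If [M] and [N] covered [D], an edge leaving [M] would end at some [b] in [N] complete to [M]. A
    vertex outside [N] lies in [M], hence sees [b] and with it all of [N], so [N] would split [D] as
    a join. *)
Lemma proper_moduleU D M N x : connected_set D -> (forall S, ~~ join_split D S) ->
  module D M -> module D N -> M != D -> N != D -> x \in M -> x \in N ->
  M :|: N != D.
Proof.
move=> Dconn nojoin modM modN MD ND xM xN; apply/eqP=> MND.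
case/moduleP: (modM) => sM mM; case/moduleP: (modN) => sN mN.
have inMN z : z \in D -> z \notin M -> z \in N.
  by rewrite -MND inE => /orP[->|].
have [y [b [yM]]] := Dconn M sM (introT (set0Pn _) (ex_intro _ x xM)) MD.
rewrite inE => /andP[bM bD] yb.
apply: (negP (nojoin N)); apply: join_splitP => //.
  by apply/set0Pn; exists x.
move=> z a zN aD aN; have aM : a \in M.
  by move: aD; rewrite -MND inE (negPf aN) orbF.
rewrite adj_sym -(mN a b z) //; last exact: inMN.
by rewrite adj_sym (mM b a y) // adj_sym.
Qed.

(* If [D] is no join, then its maximal proper modules partition it. *)
Lemma maximal_modules D : connected_set D -> (forall S, ~~ join_split D S) ->
  1 < #|D| ->
  exists Q : G -> {set G},
  [/\ {in D, forall x, [/\ module D (Q x), Q x != D & x \in Q x]} &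
      {in D, forall x N y, module D N -> N != D -> y \in N -> y \in Q x ->
        N \subset Q x}].
Proof.
move=> Dconn nojoin D_gt1.
pose P x M := [&& module D M, M != D & x \in M].
have P1 x : x \in D -> P x [set x].
  move=> xD; rewrite /P module1 // set11 andbT /=.
  by apply: contraTneq D_gt1 => <-; rewrite cards1.
exists (fun x => [arg max_(M > [set x] | P x M) #|M|]); split=> x xD.
  by case: arg_maxnP => [|M /and3P[]]; first exact: P1.
case: arg_maxnP => [|M /and3P[modM MD xM] maxM N y modN ND yN yM]; first exact: P1.
have PU : P x (M :|: N).
  by rewrite /P (moduleU modM modN yM yN) (proper_moduleU _ _ modM modN _ _ yM yN) // inE xM.
have /eqP-> : M == M :|: N by rewrite eqEcard subsetUl; apply: maxM.
exact: subsetUr.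
Qed.

(** Along a path in [S], a vertex outside [S] sees all vertices or none. A vertex in another
    component of [S] sees nothing in this one. *)
Lemma component_module D S x : x \in S -> S \subset D ->
  (forall z a b, z \in D -> z \notin S -> a \in S -> b \in S ->
     adj a b -> adj z a -> adj z b) ->
  module D (component S x).
Proof.
move=> xS sSD SE; apply/moduleP.
have sCS := component_sub xS.
split; first exact: subset_trans sSD.
move=> z a b zD zC aC bC.
case: (boolP (z \in S)) => zS.
  have nz c : c \in component S x -> adj z c = false.
    move=> cC; apply/negP=> zc; case/negP: zC.
    by apply: (component_adj xS cC zS); rewrite adj_sym.
  by rewrite !nz.
have step c : c \in component S x -> adj z x = adj z c.
  rewrite inE => /connectP[p]; elim/last_ind: p c => [c _ ->//|p y IHp c].
  rewrite rcons_path last_rcons => /andP[xp /and3P[lS yS ly]] ->.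
  rewrite (IHp _ xp erefl); apply/idP/idP; first exact: SE.
  by apply: SE => //; rewrite adj_sym.
by rewrite -(step a) // -(step b).
Qed.

(** * Bull-free graphs *)

(** The triangle is [a], [b], [c], with horn [p] at [a] and horn [q] at [b]. *)
Definition no_bull : Prop := forall a b c p q : G,
  adj a b -> adj a c -> adj b c -> adj a p -> adj b q ->
  ~~ adj a q -> ~~ adj b p -> ~~ adj c p -> ~~ adj c q -> ~~ adj p q -> False.

Section Layer.
Hypothesis bullG : no_bull.
Variables (A : {set G}) (v : G) (d : G -> nat) (par : G -> G).
Hypothesis vA : v \in A.
Let C := component A v.
Hypothesis dv : d v = 0.
Hypothesis dE : {in C &, forall x y, adj x y -> d y <= (d x).+1}.
Hypothesis parP : {in C, forall x, x != v ->
  [/\ par x \in C, adj (par x) x & d x = (d (par x)).+1]}.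

Let layer k := [set x in C | d x == k].

Lemma layerP k x : reflect (x \in C /\ d x = k) (x \in layer k).
Proof. by apply: (iffP setIdP) => -[xC /eqP]. Qed.

Lemma layer0 x : x \in layer 0 -> x = v.
Proof.
case/layerP=> xC dx; apply/eqP; apply: contraT => xv.
by case: (parP xC xv); rewrite dx.
Qed.

Lemma par_layer k x : x \in layer k.+1 -> par x \in layer k /\ adj (par x) x.
Proof.
case/layerP=> xC dx; have xv : x != v by apply: contra_eq_neq dx => ->; rewrite dv.
case: (parP xC xv) => pC px; rewrite dx => -[dp].
by split=> //; apply/layerP.
Qed.

Lemma layer_nonadj k m x y :
  k.+1 < m -> x \in layer k -> y \in layer m -> ~~ adj x y.
Proof.
move=> lt_km /layerP[xC dx] /layerP[yC dy]; apply/negP=> /(dE xC yC).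
by rewrite dx dy leqNgt lt_km.
Qed.

(* Otherwise [u], [a], [b] would be the triangle of a bull with horns [par u]
   and [z]. *)
Lemma layer_nbhd_closed k u z a b :
  u \in layer k.+1 -> z \in layer k.+2 -> a \in layer k.+2 -> b \in layer k.+2 ->
  ~~ adj u z -> adj u a -> adj u b -> adj a b -> adj z a -> adj z b.
Proof.
move=> uL zL aL bL uz ua ub ab za; apply: contraT => zb.
have [pL pu] := par_layer uL.
case: (@bullG u a b (par u) z) => //; rewrite 1?[adj u (par u)]adj_sym 1?[adj a z]adj_sym //.
- by rewrite adj_sym; apply: (layer_nonadj _ pL aL).
- by rewrite adj_sym; apply: (layer_nonadj _ pL bL).
- by rewrite adj_sym.
- exact: (layer_nonadj _ pL zL).
Qed.

(** * Sets meeting each neighbourhood from the previous layer in a stable set *)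

Section StableTransversal.
Variables (k : nat) (X : {set G}).
Hypothesis sXL : X \subset layer k.+2.
Hypothesis stableX : forall u x y, u \in layer k.+1 -> x \in X -> y \in X ->
  adj u x -> adj u y -> ~~ adj x y.

Let XL x : x \in X -> x \in layer k.+2 := subsetP sXL x.

Let parXL x (xX : x \in X) : par x \in layer k.+1 := (par_layer (XL xX)).1.

Let par_adj x (xX : x \in X) : adj (par x) x := (par_layer (XL xX)).2.

Lemma par_nonadj x y : x \in X -> y \in X -> adj x y -> ~~ adj (par x) y.
Proof.
move=> xX yX xy; apply/negP=> pxy.
by move/negP: (stableX (parXL xX) xX yX (par_adj xX) pxy).
Qed.

(** By [par_nonadj] each parent misses the other two vertices of the triangle. Nonadjacent parents
    of [x] and [y] would thus be horns of a bull on [x], [y], [z]. *)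
Lemma par_triangle x y z : x \in X -> y \in X -> z \in X ->
  adj x y -> adj x z -> adj y z -> adj (par x) (par y).
Proof.
move=> xX yX zX xy xz yz; apply: contraT => pxy.
have yx : adj y x by rewrite adj_sym.
case: (@bullG x y z (par x) (par y)) => //.
- by rewrite adj_sym par_adj.
- by rewrite adj_sym par_adj.
- by rewrite adj_sym par_nonadj.
- by rewrite adj_sym par_nonadj.
- by rewrite adj_sym par_nonadj.
- by rewrite adj_sym par_nonadj.
Qed.

End StableTransversal.

(** The parents again form a triangle. The grandparent [p] of [x] misses the parents of [y] and [z],
    so [p] and [y] are horns of a bull on the three parents. *)
Lemma transversal_triangle_free k X x y z :
  X \subset layer k.+3 ->
  (forall u x y, u \in layer k.+2 -> x \in X -> y \in X ->
     adj u x -> adj u y -> ~~ adj x y) ->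
  x \in X -> y \in X -> z \in X -> adj x y -> adj x z -> adj y z -> False.
Proof.
move=> sXL stX xX yX zX xy xz yz.
have yx : adj y x by rewrite adj_sym.
have zx : adj z x by rewrite adj_sym.
have zy : adj z y by rewrite adj_sym.
have triX := par_triangle sXL stX; have nadj := par_nonadj sXL stX.
have uxy := triX x y z xX yX zX xy xz yz.
have uxz := triX x z y xX zX yX xz xy zy.
have uyz := triX y z x yX zX xX yz yx zx.
have XL a : a \in X -> a \in layer k.+3 := subsetP sXL a.
have [uxL ux] := par_layer (XL x xX).
have [pL pu] := par_layer uxL; have [qL qp] := par_layer pL.
set p := par (par x) in pL pu qL qp; set q := par p in qL qp.
have px a : a \in X -> ~~ adj p a by move=> /XL; apply: layer_nonadj pL.
(* [p] sees no second vertex [par b] of the lifted triangle, for then [par p]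
   and [x] would be horns of a bull on [p], [par x], [par b]. *)
have pub b : b \in X -> adj x b -> adj (par x) (par b) -> ~~ adj p (par b).
  move=> bX xb uxb; apply/negP=> pb.
  have [ubL _] := par_layer (XL b bX).
  apply: (@bullG p (par x) (par b) q x) => //; rewrite 1?[adj _ q]adj_sym //.
  - exact: px.
  - exact: layer_nonadj qL uxL.
  - exact: layer_nonadj qL ubL.
  - by apply: nadj => //; rewrite adj_sym.
  - by apply: layer_nonadj qL (XL x xX); rewrite ltnW.
have [_ uy] := par_layer (XL y yX).
apply: (@bullG (par x) (par y) (par z) p y) => //.
- by rewrite adj_sym.
- exact: nadj.
- by rewrite adj_sym pub.
- by rewrite adj_sym pub.
- exact: nadj.
- exact: px.
Qed.

Lemma transversal_clique_bound k X w :
  clique_bound A w.+1 -> 1 < w -> X \subset layer k.+2 ->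
  (forall u x y, u \in layer k.+1 -> x \in X -> y \in X ->
     adj u x -> adj u y -> ~~ adj x y) ->
  clique_bound X w.
Proof.
move=> bA w_gt1 sXL stX K sKX /forall_inP cK.
have adjK x y : x \in K -> y \in K -> x != y -> adj x y.
  by move=> xK yK; move/forall_inP: (cK x xK) => /(_ y yK)/implyP.
have KX x : x \in K -> x \in X := subsetP sKX x.
rewrite leqNgt; apply/negP=> K_gtw.
(* As [1 < w < #|K|], every edge of [K] lies in a triangle of [K], which is what [par_triangle]
   needs. *)
have third x y : x \in K -> y \in K -> x != y ->
    exists z, [/\ z \in K, x != z & y != z].
  move=> xK yK xy.
  have /card_gt0P[z] : 0 < #|K :\: [set x; y]|.
    rewrite cardsD subn_gt0; apply: leq_ltn_trans (leq_ltn_trans w_gt1 K_gtw).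
    by rewrite (leq_trans (subset_leq_card (subsetIr _ _))) // cards2 xy.
  rewrite !inE negb_or -andbA => /and3P[zx zy zK].
  by exists z; rewrite zK eq_sym zx eq_sym zy.
have liftK x y : x \in K -> y \in K -> x != y -> adj (par x) (par y).
  move=> xK yK xy; have [z [zK xz yz]] := third x y xK yK xy.
  by apply: (par_triangle sXL stX (z := z)); rewrite ?KX ?adjK.
case: k => [|k] in sXL stX liftK *; last first.
  have /card_gt1P[x [y [xK yK xy]]] := leq_trans w_gt1 (ltnW K_gtw).
  have [z [zK xz yz]] := third x y xK yK xy.
  by apply: (transversal_triangle_free sXL stX (x := x) (y := y) (z := z));
    rewrite ?KX ?adjK.
have par1 x : x \in K -> par x \in layer 1.
  by move=> xK; apply: (par_layer (subsetP sXL _ (KX x xK))).1.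
have inj_par : {in K &, injective par}.
  move=> x y xK yK eqp; apply/eqP; apply: contraT => xy.
  by have := liftK x y xK yK xy; rewrite eqp adj_irr.
(* In layer 2 the parents form a clique of the same size as [K] inside the neighbourhood of [v]. *)
suff : #|par @: K| <= w by rewrite card_in_imset // leqNgt K_gtw.
have sLA : layer 1 \subset A.
  apply/subsetP=> x /layerP[xC _]; exact: subsetP (component_sub vA) _ xC.
apply: (clique_boundS bA vA sLA).
- move=> x xL; have [/layer0 px] := par_layer xL.
  by rewrite px.
- by apply/subsetP=> _ /imsetP[x xK ->]; apply: par1.
- apply/forall_inP=> _ /imsetP[x xK ->]; apply/forall_inP=> _ /imsetP[y yK ->].
  apply/implyP=> pxy; apply: liftK => //.
  by apply: contraNneq pxy => ->.
Qed.

(** * Colouring a single layer *)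

Lemma layer_colorable k w n : clique_bound A w.+1 -> 1 < w ->
  (forall B, clique_bound B w -> set_colorable B n) ->
  set_colorable (layer k) ((n + 2) ^ 2).
Proof.
move=> bA w_gt1 colB.
have sLA m : layer m \subset A.
  apply/subsetP=> x /layerP[xC _]; exact: subsetP (component_sub vA) _ xC.
(* The bound dominates each case below: [n] for a neighbourhood or a set of at most one vertex,
   [n + n] for a join, [n * n] for the product colouring. *)
have le_n : n <= (n + 2) ^ 2.
  by rewrite (leq_trans (leq_addr 2 n)) // -mulnn leq_pmull // addn2.
have le_nn : n + n <= (n + 2) ^ 2.
  by rewrite addnn -muln2 -mulnn leq_mul ?leq_addr ?leq_addl.
have le_sqr : n * n <= (n + 2) ^ 2 by rewrite -mulnn leq_mul ?leq_addr.
have col1 D : #|D| <= 1 -> set_colorable D n.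
  move=> D1; apply: colB => K sKD _; apply: leq_trans (ltnW w_gt1).
  exact: leq_trans (subset_leq_card sKD) D1.
case: k => [|[|k]].
- apply: (set_colorable_le (subxx _) le_n); apply: col1.
  rewrite -(cards1 v) subset_leq_card //.
  by apply/subsetP=> x /layer0->; rewrite inE.
- apply: (set_colorable_le (subxx _) le_n); apply: colB.
  apply: (clique_boundS bA vA) => // x xL.
  by have [/layer0 px] := par_layer xL; rewrite px.
apply: set_colorable_components => x0 x0L; set D := component _ _.
have sDL : D \subset layer k.+2 := component_sub x0L.
have sDA := subset_trans sDL (sLA _).
have Dconn : connected_set D by move=> S; apply: component_connected.
case: (boolP [exists S, join_split D S]) => [/existsP[S joinS]|].
  exact: (set_colorable_le (subxx _) le_nn (join_split_colorable sDA bA colB joinS)).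
rewrite negb_exists => /forallP nojoin.
(* When no vertex of [A] dominates [D], the modules built from neighbourhoods in [stX] are
   proper. *)
case: (boolP [exists u in A, [forall x in D, adj u x]]) => [/exists_inP[u uA /forall_inP uD]|].
  apply: (set_colorable_le (subxx _) le_n); apply: colB.
  exact: (clique_boundS bA uA sDA uD).
rewrite negb_exists_in => /forall_inP nodom.
case: (leqP #|D| 1) => [/col1|D_gt1].
  exact: set_colorable_le.
have [Q [QP Qmax]] := maximal_modules Dconn nojoin D_gt1.
have Qeq x y : x \in D -> y \in D -> y \in Q x -> Q y = Q x.
  move=> xD yD yQ; have [mx px xQ] := QP x xD; have [my py yy] := QP y yD.
  have sub : Q y \subset Q x by apply: (Qmax x xD _ y).
  apply/eqP; rewrite eqEsubset sub.
  exact: (Qmax y yD _ y).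
pose rep x := odflt x [pick y in Q x].
have repQ x : x \in D -> rep x \in Q x.
  move=> xD; rewrite /rep; case: pickP => //= /(_ x).
  by case: (QP x xD) => _ _ ->.
have QD x : x \in D -> Q x \subset D.
  by move=> xD; case: (QP x xD) => /moduleP[].
have repD x : x \in D -> rep x \in D.
  by move=> xD; apply: (subsetP (QD x xD)); apply: repQ.
have Qrep x : x \in D -> Q (rep x) = Q x.
  by move=> xD; apply: Qeq => //; [apply: repD|apply: repQ].
have rep_eq x y : x \in D -> Q x = Q y -> rep x = rep y.
  move=> xD eQ; rewrite /rep eQ; case: pickP => //= /(_ x).
  by rewrite /= -eQ; case: (QP x xD) => _ _ ->.
have adj_rep x y : x \in D -> y \in D -> Q x != Q y -> adj x y ->
    adj (rep x) (rep y).
  move=> xD yD neQ xy.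
  have [/moduleP[_ mx] _ xQ] := QP x xD; have [/moduleP[_ my] _ yQ] := QP y yD.
  have xNy : rep x \notin Q y.
    apply: contraNN neQ => ryx; rewrite -(Qrep x xD); apply/eqP; apply: Qeq => //.
    exact: repD.
  have yNx : y \notin Q x by apply: contraNN neQ => yx; rewrite (Qeq x y).
  rewrite (my (rep x) (rep y) y) ?repD ?repQ //.
  by rewrite adj_sym (mx y (rep x) x) ?repQ // adj_sym.
pose X := rep @: D.
have XE x : x \in X -> x \in D /\ rep x = x.
  by case/imsetP=> y yD ->; split; [apply: repD|apply: rep_eq; [apply: repD|apply: Qrep]].
have XD : X \subset D by apply/subsetP=> x /XE[].
(* The component of [x] among the neighbours of [u] in [D] is a proper module, hence contained in
   [Q x]. It contains [y], so [x] and [y] represent the same module and coincide. *)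
have stX u x y : u \in layer k.+1 -> x \in X -> y \in X ->
    adj u x -> adj u y -> ~~ adj x y.
  move=> uL /XE[xD rx] /XE[yD ry] ux uy; apply/negP=> xy.
  pose S := [set z in D | adj u z].
  have xS : x \in S by rewrite inE xD.
  have yS : y \in S by rewrite inE yD.
  have sSD : S \subset D by apply/subsetP=> z; rewrite inE => /andP[].
  have modS : module D (component S x).
    apply: component_module => // z a b zD zS.
    move=> /setIdP[aD ua] /setIdP[bD ub].
    apply: (layer_nbhd_closed uL); rewrite ?(subsetP sDL) //.
    by apply: contraNN zS => uz; rewrite inE zD.
  have neS : component S x != D.
    apply/eqP=> eSD; case/negP: (nodom u (subsetP (sLA _) _ uL)).
    apply/forall_inP=> z; rewrite -eSD => /(subsetP (component_sub xS)).
    by rewrite inE => /andP[].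
  have yQ : y \in Q x.
    have [_ _ xQ] := QP x xD.
    apply: (subsetP (Qmax x xD _ x modS neS (mem_component _ _) xQ)).
    exact: component_adj xS (mem_component _ _) yS xy.
  have eQ := Qeq x y xD yD yQ.
  by move: xy; rewrite -rx -ry (rep_eq x y xD) ?adj_irr.
have [c cX cE] : set_colorable X n.
  apply: colB; apply: transversal_clique_bound stX => //.
  exact: subset_trans sDL.
apply: (set_colorable_le (subxx _) le_sqr).
apply: (@set_colorable_fibers _ D Q (c \o rep)) => [x xD|x y xD yD xy neQ|x xD] /=.
- by apply: cX; apply: imset_f.
- by apply: cE; rewrite ?imset_f // adj_rep.
have [/moduleP[sQ mQ] neQ xQ] := QP x xD.
(* An edge leaving the module [Q x] ends at a vertex [b] complete to [Q x], which lowers the clique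
   number. *)
have [a [b [aQ]]] := Dconn (Q x) sQ (introT (set0Pn _) (ex_intro _ x xQ)) neQ.
rewrite inE => /andP[bQ bD] ab.
have /colB : clique_bound (Q x) w.
  apply: (clique_boundS bA (subsetP sDA _ bD)); first exact: subset_trans sDA.
  by move=> z zQ; rewrite (mQ b z a) // adj_sym.
apply: set_colorable_le => //; apply/subsetP=> y; rewrite inE => /andP[yD /eqP<-].
by case: (QP y yD).
Qed.

End Layer.

(** * Induction on the clique number *)

Fixpoint color_bound t n : nat :=
  if n is n'.+1 then 2 * (color_bound t n' + 2) ^ 2 else t.

(** The induction starts at clique number 2, the triangle-free case, so each step has
    [w = n + 2 > 1] as [layer_colorable] requires. *)
Lemma no_bull_colorable t n A : no_bull ->
  (forall B, clique_bound B 2 -> set_colorable B t) ->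
  clique_bound A (n + 2) -> set_colorable A (color_bound t n).
Proof.
move=> bullG colt; elim: n A => [|n IHn] A bA /=; first exact: colt.
apply: set_colorable_components => v vA.
have [d [par [dv dE parP]]] := component_layers vA.
(* Edges join equal or consecutive layers, so parity separates adjacent vertices of distinct layers;
   hence the factor 2 in [color_bound]. *)
apply: (@set_colorable_fibers _ _ d (fun x => odd (d x))).
- by move=> x _; case: odd.
- move=> x y xC yC xy; have := dE x y xC yC xy.
  have : d x <= (d y).+1 by apply: dE => //; rewrite adj_sym.
  rewrite leq_eqVlt => /orP[/eqP-> _ _|]; first by rewrite /=; case: odd.
  rewrite ltnS => le1; rewrite leq_eqVlt => /orP[/eqP-> _|].
    by rewrite /=; case: odd.
  by rewrite ltnS => le2; rewrite eqn_leq le1 le2.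
move=> x xC.
by apply: (layer_colorable bullG vA dv dE parP (d x) (w := n + 2)) => //; rewrite addn2.
Qed.

End SetColoring.

(** * Transfer to [bull_free], [chi] and [chiT] *)

Lemma induced_image_isomorphic (G H : sgraph) (g : H -> G) :
  injective g -> (forall i j, adj (g i) (g j) = adj i j) ->
  isomorphic (induced (g @: setT)) H.
Proof.
move=> inj_g gE.
have gT i : g i \in g @: setT by apply: imset_f; rewrite inE.
pose h i : induced (g @: setT) := exist _ (g i) (gT i).
have inj_h : injective h by move=> i j /(congr1 val)/inj_g.
have /fin_all_exists[f fK] (u : induced (g @: setT)) : exists i, h i = u.
  by case: u => x xg; have /imsetP[i _ xi] := xg; exists i; apply: val_inj.
have hK : cancel h f by move=> i; apply: inj_h.
exists f; first by exists h.
by move=> x y; rewrite -gE -{2}(fK x) -{2}(fK y).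
Qed.

Lemma bull_free_no_bull (G : sgraph) : bull_free G -> no_bull G.
Proof.
move=> bfG a b c p q ab ac bc ap bq aq bp cp cq pq.
pose g (i : bull) := nth a [:: a; b; c; p; q] (i : 'I_5).
have gE i j : adj (g i) (g j) = adj i j.
  have S (x y : G) (s : bool) : adj x y = s -> adj y x = s by rewrite adj_sym.
  move: (S _ _ _ ab) (S _ _ _ ac) (S _ _ _ bc) (S _ _ _ ap) (S _ _ _ bq) => *.
  move: (negPf aq) (negPf bp) (negPf cp) (negPf cq) (negPf pq).
  move=> naq nbp ncp ncq npq.
  move: (S _ _ _ naq) (S _ _ _ nbp) (S _ _ _ ncp) (S _ _ _ ncq) (S _ _ _ npq) => *.
  by case: i j => -[|[|[|[|[|i]]]]] // ? [[|[|[|[|[|j]]]]] // ?];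
    rewrite /g /= ?adj_irr.
(* Distinct vertices of the bull have distinct neighbourhoods, so preserving adjacency and
   non-adjacency forces injectivity. *)
have inj_g : injective g.
  move=> i j gij; have E k : bull_adj i k = bull_adj j k.
    by rewrite -[bull_adj i k]gE -[bull_adj j k]gE gij.
  apply/val_inj; move: (E (inord 0)) (E (inord 1)) (E (inord 2)) (E (inord 3)) (E (inord 4)).
  rewrite /bull_adj !inordK //.
  by case: i j {gij E} => -[|[|[|[|[|i]]]]] // ? [[|[|[|[|[|j]]]]] // ?].
exact: bfG (induced_image_isomorphic inj_g gE).
Qed.

Lemma colorable_chi (G : sgraph) : colorable G (chi G).
Proof. by rewrite /chi; case: ex_minnP. Qed.

Lemma set_colorable_chi (G : sgraph) n : set_colorable [set: G] n -> chi G <= n.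
Proof.
case=> c cn cE; rewrite /chi; case: ex_minnP => m _; apply.
have lt_c (x : G) : c x < n by apply: cn; rewrite inE.
apply/existsP; exists [ffun x => Ordinal (lt_c x)].
apply/forallP=> x; apply/forallP=> y; apply/implyP=> xy.
by rewrite !ffunE -val_eqE /= cE ?inE.
Qed.

Lemma set_colorable_induced (G : sgraph) (A : {set G}) :
  set_colorable A (chi (induced A)).
Proof.
have /existsP[c /forallP cE] := colorable_chi (induced A).
(* The value 0 is taken only outside [A]. *)
exists (fun x => if insub x is Some u then c u : nat else 0) => [x xA|x y xA yA xy].
  by rewrite insubT ltn_ord.
rewrite !insubT /= val_eqE.
by move/forallP: (cE (Sub x xA)) => /(_ (Sub y yA))/implyP; apply.
Qed.

(** A triangle of [induced A] would be a clique of three vertices in [A], so [induced A] takes part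
    in the maximum defining [chiT]. *)
Lemma set_colorable_chiT (G : sgraph) (A : {set G}) :
  clique_bound A 2 -> set_colorable A (chiT G).
Proof.
move=> bA; apply: set_colorable_le (subxx _) _ (set_colorable_induced A).
apply: (@leq_bigmax_cond _ (fun B : {set G} => triangle_free (induced B))
  (fun B : {set G} => chi (induced B))).
apply/existsP=> -[[x xA] /existsP[[y yA] /existsP[[z zA]]]].
rewrite /= /induced_adj /= => /and3P[xy yz xz].
have ne (a b : G) : adj a b -> a != b.
  by move=> ab; apply: contraTneq ab => ->; rewrite adj_irr.
have K3 : #|x |: [set y; z]| = 3 by rewrite cardsU1 cards2 !inE negb_or !ne.
have /bA : x |: [set y; z] \subset A by rewrite !subUset !sub1set xA yA.
rewrite K3 => bK; suff /bK : clique (x |: [set y; z]) by [].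
apply/forall_inP=> a; rewrite !inE => aK; apply/forall_inP=> b; rewrite !inE => bK'.
apply/implyP.
by case/or3P: aK => /eqP->; case/or3P: bK' => /eqP->; rewrite ?eqxx // adj_sym.
Qed.

Theorem theorem8p2 :
  exists f : nat -> nat -> nat,
    forall G : sgraph, bull_free G -> chi G <= f (chiT G) (omega G).
Proof.
(* The subtraction is truncated: for [w] below 2 the bound is [t], and [w <= (w - 2) + 2] still
   holds. *)
exists (fun t w => color_bound t (w - 2)) => G bfG.
apply: set_colorable_chi; apply: no_bull_colorable.
- exact: bull_free_no_bull.
- exact: set_colorable_chiT.
move=> K _ cK; apply: (@leq_trans (omega G)); last by rewrite addnC -leq_subLR.
exact: (@leq_bigmax_cond _ (@clique G) (fun K : {set G} => #|K|)).
Qed.
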